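(* Let $K$ be a knot, let $\rho_1(K)\in\mathbf C[T^{\pm1}]$ be its Rozansky-Overbay invariant and let $\theta(K)\in\mathbf C[T_1^{\pm1},T_2^{\pm1}]$ be its $\theta$ invariant. Then $$\rho_1(K)=-\theta(K)\big|_{T_1\leftarrow 1,\;T_2\leftarrow T}.$$
   Context: **Upright knot diagrams.** An upright knot diagram $D$ is an oriented long knot diagram in the plane such that at each crossing both overlapping strands point upwards, and the two ends of the diagram also point upwards. Every knot admits such a diagram (crossings can be rotated to make them upright). Suppose $D$ has $n$ crossings. Starting at the initial edge, label the edges $k=1,\ldots,2n+1$ consecutively along the orientation of the knot. The geometric rotation number $\varphi_k$ of edge $k$ is the signed number of times that the tangent to edge $k$ is horizontal and heading right, where cups (local minima) are counted with sign $+1$ and caps (local maxima) with sign $-1$. Each crossing $c$ is denoted by a triple $(s,i,j)$, where $s\in\{+1,-1\}$ is the sign of $c$, $i$ is the label of the incoming overcrossing edge and $j$ is the label of the incoming undercrossing edge (so the outgoing edges are $i+1$ and $j+1$ respectively). Let $X$ be the set of all crossings $c=(s,i,j)$ of $D$. **The matrices $A$ and $G$, and the Alexander polynomial.** Let $T$ be an indeterminate and define the $(2n+1)\times(2n+1)$ matrix of Laurent polynomials $$A=I-\sum_{c=(s,i,j)\in X}\left(T^s E_{i,i+1}+(1-T^s)E_{i,j+1}+E_{j,j+1}\right),$$ where $E_{pq}$ is the elementary matrix with entry $1$ at $(p,q)$ and $0$ elsewhere. Let $G=(g_{\alpha\beta}):=A^{-1}$ (inverse over the field of rational functions in $T$).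 The normalized Alexander polynomial is $$\Delta:=T^{(-\varphi(D)-w(D))/2}\det(A),\qquad \varphi(D)=\sum_k\varphi_k,\quad w(D)=\sum_{c=(s,i,j)\in X}s.$$ **The invariant $\rho_1$.** For a crossing $c=(s,i,j)$ let $$R_1(c)=s\left(g_{ji}(g_{j+1,j}+g_{j,j+1}-g_{ij})-g_{ii}(g_{j,j+1}-1)-\tfrac12\right),$$ and define $$\rho_1(D):=\Delta^2\left(\sum_{c\in X} R_1(c)-\sum_{k}\varphi_k\left(g_{kk}-\tfrac12\right)\right)\in\mathbf C[T^{\pm1}],$$ where $k$ runs over all edges. It is known that $\rho_1(D)$ depends only on the knot $K$ represented by $D$; this common value is $\rho_1(K)$. **The invariant $\theta$.** Let $T_1,T_2$ be indeterminates and $T_3:=T_1T_2$. For $\nu=1,2,3$ let $\Delta_\nu:=\Delta|_{T\leftarrow T_\nu}$ and $G_\nu=(g_{\nu\alpha\beta}):=G|_{T\leftarrow T_\nu}$ (so $g_{\nu\alpha\beta}$ is $g_{\alpha\beta}$ with $T$ replaced by $T_\nu$). For a crossing $c=(s,i,j)$, crossings $c_0=(s_0,i_0,j_0)$, $c_1=(s_1,i_1,j_1)$, and an edge $k$, define $$\begin{aligned} F_1(c)={}& s\Big[\tfrac12-g_{3ii}+T_2^s g_{1ii}g_{2ji}-T_2^s g_{3jj}g_{2ji}-(T_2^s-1)g_{3ii}g_{2ji}\\ &\quad+(T_3^s-1)g_{2ji}g_{3ji}-g_{1ii}g_{2jj}+2g_{3ii}g_{2jj}+g_{1ii}g_{3jj}-g_{2ii}g_{3jj}\Big]\\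 &+\frac{s}{T_2^s-1}\Big[(T_1^s-1)T_2^s\left(g_{3jj}g_{1ji}-g_{2jj}g_{1ji}+T_2^s g_{1ji}g_{2ji}\right)\\ &\quad+(T_3^s-1)g_{3ji}\left(1-T_2^s g_{1ii}+g_{2ij}+(T_2^s-2)g_{2jj}-(T_1^s-1)(T_2^s+1)g_{1ji}\right)\Big], \end{aligned}$$ $$F_2(c_0,c_1)=\frac{s_1(T_1^{s_0}-1)(T_3^{s_1}-1)\,g_{1j_1i_0}\,g_{3j_0i_1}}{T_2^{s_1}-1}\left(T_2^{s_0}g_{2i_1i_0}+g_{2j_1j_0}-T_2^{s_0}g_{2j_1i_0}-g_{2i_1j_0}\right),$$ $$F_3(k)=\varphi_k\left(g_{3kk}-\tfrac12\right).$$ Define $$\theta(D):=\Delta_1\Delta_2\Delta_3\left(\sum_{c\in X}F_1(c)+\sum_{c_0,c_1\in X}F_2(c_0,c_1)+\sum_kF_3(k)\right),$$ where the second sum is over all ordered pairs of crossings (including $c_0=c_1$) and $k$ runs over all edges. It is known that $\theta(D)$ is a Laurent polynomial in $\mathbf C[T_1^{\pm1},T_2^{\pm1}]$ and depends only on the knot $K$ represented by $D$; this common value is $\theta(K)$. *)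

(* Defs.v *)
From HB Require Import structures.
From mathcomp Require Import all_boot all_order all_algebra.
From mathcomp Require Import reals complex.

Set Implicit Arguments.
Unset Strict Implicit.
Unset Printing Implicit Defensive.

Import Order.TTheory GRing.Theory Num.Theory.

(* A long knot diagram in the plane, in general position with respect to the
   height function, is recorded as the list, from bottom to top, of its
   crossings and of its local minima and maxima.  The argument q is the number
   of strands passing to the left of the event.  [Cross true q] is the crossing
   whose overstrand goes from lower left to upper right, [Cross false q] the
   one whose overstrand goes from lower right to upper left. *)
Inductive event :=
  | Cup of nat
  | Cap of nat
  | Cross of bool & nat.

Definition position (e : event) : nat :=
  match e with Cup q => q | Cap q => q | Cross _ q => q end.

Definition strands_in (e : event) : nat := if e is Cup _ then 0 else 2.

Definition strands_out (e : event) : nat := if e is Cap _ then 0 else 2.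

Definition width_after (m : nat) (e : event) : nat :=
  m - strands_in e + strands_out e.

(* One strand at the bottom, one at the top, and enough strands for every
   event in between: a planar (1,1)-tangle diagram. *)
Definition is_long_tangle (w : seq event) : bool :=
  let fix fits m w :=
    if w is e :: w' then
      (position e + strands_in e <= m) && fits (width_after m e) w'
    else m == 1
  in fits 1 w.

(* A piece (h, p) is the p-th strand from the left (counted from 0) at the
   level just below the event number h. *)
Definition pieces (w : seq event) : seq (nat * nat) :=
  let widths := 1 :: scanl width_after 1 w in
  [seq (h, p) | h <- iota 0 (size w).+1, p <- iota 0 (nth 0 widths h)].

(* A piece traversed upwards (true) or downwards (false). *)
Definition state : Type := (nat * nat) * bool.

Definition swap (q p : nat) : nat :=
  if p == q then q.+1 else if p == q.+1 then q else p.

Definition touches (q p : nat) : bool := (p == q) || (p == q.+1).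

Definition go_up (h p : nat) (e : event) : state :=
  match e with
  | Cup q => ((h.+1, if p < q then p else p.+2), true)
  | Cap q => if touches q p then ((h, swap q p), false)
             else ((h.+1, if p < q then p else p.-2), true)
  | Cross _ q => ((h.+1, swap q p), true)
  end.

(* Here e is the event number h, reached from the level h.+1 above it. *)
Definition go_down (h p : nat) (e : event) : state :=
  match e with
  | Cup q => if touches q p then ((h.+1, swap q p), true)
             else ((h, if p < q then p else p.-2), false)
  | Cap q => ((h, if p < q then p else p.+2), false)
  | Cross _ q => ((h, swap q p), false)
  end.

(* The last branch is reached only above the last event (or below the first
   one), where the walk stops. *)
Definition next_state (w : seq event) (x : state) : state :=
  match x with
  | ((h, p), true) => if onth w h is Some e then go_up h p e else x
  | ((h'.+1, p), false) => if onth w h' is Some e then go_down h' p e else x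
  | _ => x
  end.

(* The knot, followed from its bottom end. *)
Definition walk (w : seq event) : seq state :=
  traject (next_state w) ((0, 0), true) (size (pieces w)).

(* The tangle has no closed component: the walk from the bottom end runs
   through every piece exactly once. *)
Definition is_long_knot (w : seq event) : bool :=
  is_long_tangle w && perm_eq [seq x.1 | x <- walk w] (pieces w).

Definition upright_at (w : seq event) (h : nat) : bool :=
  if onth w h is Some (Cross _ q) then
    (((h, q), true) \in walk w) && (((h, q.+1), true) \in walk w)
  else true.

(* The walk starts and ends upwards, so both ends of the diagram always point
   upwards. *)
Record upright_diagram := UprightDiagram {
  events :> seq event;
  _ : is_long_knot events && all (upright_at events) (iota 0 (size events))
}.

(* Planar isotopies and Reidemeister moves, for unoriented tangle diagrams in
   the height presentation.  In [move_far], e lies to the left of e'. *)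
Definition reposition (q : nat) (e : event) : event :=
  match e with Cup _ => Cup q | Cap _ => Cap q | Cross b _ => Cross b q end.

Inductive move : seq event -> seq event -> Prop :=
  | move_far e e' of position e + strands_out e <= position e' :
      move [:: e; e']
        [:: reposition (position e' - strands_out e + strands_in e) e'; e]
  | move_zigzag_left q : move [:: Cup q; Cap q.+1] [::]
  | move_zigzag_right q : move [:: Cup q.+1; Cap q] [::]
  | move_slide_cap b q :
      move [:: Cross b q; Cap q.+1] [:: Cross (~~ b) q.+1; Cap q]
  | move_slide_cup b q :
      move [:: Cup q.+1; Cross b q] [:: Cup q; Cross (~~ b) q.+1]
  | move_R1_cap b q : move [:: Cross b q; Cap q] [:: Cap q]
  | move_R1_cup b q : move [:: Cup q; Cross b q] [:: Cup q]
  | move_R2 b q : move [:: Cross b q; Cross (~~ b) q] [::]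
  | move_R3 b q :
      move [:: Cross b q; Cross b q.+1; Cross b q]
           [:: Cross b q.+1; Cross b q; Cross b q.+1].

Inductive isotopic : seq event -> seq event -> Prop :=
  | isotopic_refl w : isotopic w w
  | isotopic_sym w w' : isotopic w w' -> isotopic w' w
  | isotopic_trans w w' w'' :
      isotopic w w' -> isotopic w' w'' -> isotopic w w''
  | isotopic_move u v below above of move u v
      & is_long_knot (below ++ u ++ above)
      & is_long_knot (below ++ v ++ above) :
      isotopic (below ++ u ++ above) (below ++ v ++ above).

(* An (oriented) knot in 3-space, as the isotopy class of its long diagrams
   (upright or not). *)
Record knot := Knot {
  diagram_of : seq event -> Prop;
  _ : exists2 w, is_long_knot w & forall w', diagram_of w' <-> isotopic w w'
}.

Definition represents (D : upright_diagram) (K : knot) : Prop :=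
  diagram_of K D.

(* Edges are numbered from 0 to 2n along the knot, instead of 1 to 2n+1. *)

Definition enters_crossing (w : seq event) (x : state) : bool :=
  if onth w x.1.1 is Some (Cross _ q) then x.2 && touches q x.1.2 else false.

Definition edge_at_time (w : seq event) (t : nat) : nat :=
  count (enters_crossing w) (take t (walk w)).

Definition edge_of_piece (w : seq event) (a : nat * nat) : nat :=
  edge_at_time w (index a [seq x.1 | x <- walk w]).

(* The triple (s, i, j): sign, incoming over edge, incoming under edge.  Both
   strands point upwards, so [Cross true _] is positive. *)
Definition crossing_at (w : seq event) (h : nat) : option (int * nat * nat) :=
  if onth w h is Some (Cross b q) then
    let left := edge_of_piece w (h, q) in
    let right := edge_of_piece w (h, q.+1) in
    Some (if b then (1%R, left, right) else ((-1)%R, right, left))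
  else None.

Definition crossings (w : seq event) : seq (int * nat * nat) :=
  pmap (crossing_at w) (iota 0 (size w)).

(* Contribution of the turn following the state x: +1 for a cup and -1 for a
   cap, counted only if it is run through from left to right. *)
Definition right_turn (w : seq event) (x : state) : int :=
  match x with
  | ((h, p), true) =>
      if onth w h is Some (Cap q) then (if p == q then (-1)%R else 0%R)
      else 0%R
  | ((h'.+1, p), false) =>
      if onth w h' is Some (Cup q) then (if p == q then 1%R else 0%R)
      else 0%R
  | _ => 0%R
  end.

Local Open Scope ring_scope.

Local Notation "x %:F" := (FracField.tofrac x).

Definition rotation (w : seq event) (k : nat) : int :=
  \sum_(0 <= t < size (walk w) | edge_at_time w t == k)
    right_turn w (nth ((0%N, 0%N), true) (walk w) t).

Definition ncross (w : seq event) : nat := size (crossings w).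

Definition last_edge (w : seq event) : nat := (ncross w).*2.

Definition total_rotation (w : seq event) : int :=
  \sum_(0 <= k < (last_edge w).+1) rotation w k.

Definition writhe (w : seq event) : int := \sum_(c <- crossings w) c.1.1.

(* The long trefoil closing up the braid with three positive crossings. *)
Definition trefoil : seq event :=
  [:: Cup 1; Cross true 0; Cross true 0; Cross true 0; Cap 1].

Example trefoil_upright :
  is_long_knot trefoil && all (upright_at trefoil) (iota 0 (size trefoil)).
Proof. by []. Qed.

Example trefoil_crossings :
  crossings trefoil = [:: (1, 0%N, 3%N); (1, 4%N, 1%N); (1, 2%N, 5%N)].
Proof. by []. Qed.

(* T is any nonzero element of a field F.  Taking T = T_nu in C(T1, T2) in the
   definitions below amounts to substituting T_nu for the indeterminate of
   C(T), since this substitution is a morphism of fields. *)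

Section Alexander.
Variables (F : fieldType) (D : upright_diagram) (T : F).

Definition unit_mx (i j : nat) : 'M[F]_((last_edge D).+1) :=
  delta_mx (inord i) (inord j).

Definition A_mx : 'M[F]_((last_edge D).+1) :=
  1%:M - \sum_(c <- crossings D) let: (s, i, j) := c in
    (T ^ s *: unit_mx i i.+1 + (1 - T ^ s) *: unit_mx i j.+1
     + unit_mx j j.+1).

Definition green (a b : nat) : F := invmx A_mx (inord a) (inord b).

(* The division by 2 is exact, the rotation number and the writhe of a
   diagram having the same parity. *)
Definition Alexander : F :=
  T ^ ((- total_rotation D - writhe D) %/ 2)%Z * \det A_mx.

Definition R1 (c : int * nat * nat) : F :=
  let: (s, i, j) := c in
  let g := green in
  s%:~R * (g j i * (g j.+1 j + g j j.+1 - g i j)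
           - g i i * (g j j.+1 - 1) - 2^-1).

End Alexander.

Section Rho1.
Variables (C : fieldType) (D : upright_diagram).

Definition varT : {fraction {poly C}} := ('X : {poly C})%:F.

Definition rho1 : {fraction {poly C}} :=
  let g := green D varT in
  Alexander D varT ^+ 2 *
  (\sum_(c <- crossings D) R1 D varT c
   - \sum_(0 <= k < (last_edge D).+1) (rotation D k)%:~R * (g k k - 2^-1)).

End Rho1.

Section Theta.
Variables (C : fieldType) (D : upright_diagram).

(* C(T1, T2) is the fraction field of C[T2][T1]. *)
Definition T1 : {fraction {poly {poly C}}} := ('X : {poly {poly C}})%:F.
Definition T2 : {fraction {poly {poly C}}} := (('X : {poly C})%:P)%:F.
Definition T3 : {fraction {poly {poly C}}} := T1 * T2.

Let g1 := green D T1.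
Let g2 := green D T2.
Let g3 := green D T3.

Definition F1 (c : int * nat * nat) : {fraction {poly {poly C}}} :=
  let: (s, i, j) := c in
  s%:~R * (2^-1 - g3 i i + T2 ^ s * g1 i i * g2 j i - T2 ^ s * g3 j j * g2 j i
           - (T2 ^ s - 1) * g3 i i * g2 j i + (T3 ^ s - 1) * g2 j i * g3 j i
           - g1 i i * g2 j j + 2 * g3 i i * g2 j j + g1 i i * g3 j j
           - g2 i i * g3 j j)
  + s%:~R / (T2 ^ s - 1) *
    ((T1 ^ s - 1) * T2 ^ s *
       (g3 j j * g1 j i - g2 j j * g1 j i + T2 ^ s * g1 j i * g2 j i)
     + (T3 ^ s - 1) * g3 j i *
       (1 - T2 ^ s * g1 i i + g2 i j + (T2 ^ s - 2) * g2 j j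
        - (T1 ^ s - 1) * (T2 ^ s + 1) * g1 j i)).

Definition F2 (c0 c1 : int * nat * nat) : {fraction {poly {poly C}}} :=
  let: (s0, i0, j0) := c0 in
  let: (s1, i1, j1) := c1 in
  s1%:~R * (T1 ^ s0 - 1) * (T3 ^ s1 - 1) * g1 j1 i0 * g3 j0 i1
  / (T2 ^ s1 - 1) *
  (T2 ^ s0 * g2 i1 i0 + g2 j1 j0 - T2 ^ s0 * g2 j1 i0 - g2 i1 j0).

Definition F3 (k : nat) : {fraction {poly {poly C}}} :=
  (rotation D k)%:~R * (g3 k k - 2^-1).

Definition theta : {fraction {poly {poly C}}} :=
  Alexander D T1 * Alexander D T2 * Alexander D T3 *
  (\sum_(c <- crossings D) F1 c
   + \sum_(c0 <- crossings D) \sum_(c1 <- crossings D) F2 c0 c1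
   + \sum_(0 <= k < (last_edge D).+1) F3 k).

End Theta.

(* f is regular along T1 = 1 and its value under T1 <- 1, T2 <- T is r.  Such
   an r is unique, and exists for every Laurent polynomial f. *)
Definition specializes_at_T1_1 (C : fieldType)
    (f : {fraction {poly {poly C}}}) (r : {fraction {poly C}}) : Prop :=
  exists N M : {poly {poly C}},
    [/\ M.[1] != 0, f = N%:F / M%:F & r = N.[1]%:F / M.[1]%:F].

(* Main.v *)
Require Import Defs.
From mathcomp Require Import all_boot all_order all_algebra.
From mathcomp Require Import reals complex.
From mathcomp Require Import ring zify.

(** Both sides are computed from the same diagram D.  At T = 1 each crossing
    contributes E_{i,i+1} + E_{j,j+1} to I - A, so that A is unitriangular there:
    det A, hence the Alexander polynomial, becomes 1, and so do the diagonal
    entries of G.  Under T1 <- 1, T2 <- T, both G_2 and G_3 become G, while G_1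
    becomes a constant matrix with diagonal 1, and the prefactor
    Delta_1 Delta_2 Delta_3 becomes Delta^2.  Every F2 carries the factor
    T1^s0 - 1 and dies; F3 becomes the rotation term of - rho_1.

    The substance is that F1 becomes - R1.  The off-diagonal entries of G_1
    disappear from F1, as they come with a factor T1^s - 1, and the factor
    T3^s - 1 cancels the denominator T2^s - 1.  What is left agrees with - R1
    once R1 is rewritten by means of
      g_{j+1,j} = g_{jj} - 1   and   g_{j,j+1} = (1 - T^s) g_{ji} + g_{jj},
    which are one entry each of A G = I and of G A = I
    ([green_under_next_row], [green_under_next_col]).

    These two relations hold because row j and column j+1 of A see no other
    crossing than (s,i,j), that is, because the 2n strands entering the
    crossings carry distinct labels.  Unitriangularity needs these labels to be
    less than 2n, so that i+1 and j+1 are indices of the matrix.  Both facts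
    come from the definition of a label as the number of entries into crossings
    met before it along the knot: this number increases strictly at each entry
    ([edge_of_piece_inj]), and there are at most 2n entries
    ([count_enters_le]).

    Specialization is handled as a relation between rational functions that is
    compatible with the field operations, the only condition being that the
    specialized denominators do not vanish.  For the inverses of A this requires
    det A to be nonzero as a rational function of T, which follows by
    specializing once more, at T = 1. *)

Set Implicit Arguments.
Unset Strict Implicit.
Unset Printing Implicit Defensive.

Import GRing.Theory.

Local Open Scope ring_scope.

Local Notation "x %:F" := (FracField.tofrac x).

(** * Specialization of rational functions *)

Section Specialization.
Variables (R S : idomainType) (phi : {rmorphism R -> S}).

(** A relation rather than a function on the localization of R at the kernel of
    phi: it spares the construction of that ring, and a value is only ever
    claimed by exhibiting it. *)
Definition specializes (f : {fraction R}) (r : {fraction S}) : Prop :=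
  exists N M : R,
    [/\ phi M != 0, f = N%:F / M%:F & r = (phi N)%:F / (phi M)%:F].

Lemma rmorph_neq0 (x : R) : phi x != 0 -> x != 0.
Proof. by apply: contraNneq => ->; rewrite rmorph0. Qed.

Lemma specializes_tofrac (x : R) : specializes x%:F (phi x)%:F.
Proof.
by exists x, 1; rewrite !rmorph1 oner_neq0 !divr1.
Qed.

Lemma specializes_int (z : int) : specializes z%:~R z%:~R.
Proof.
have:= specializes_tofrac z%:~R.
by rewrite !rmorph_int.
Qed.

Lemma specializes_nat (n : nat) : specializes n%:R n%:R.
Proof. exact: (specializes_int n). Qed.

Lemma specializes_0 : specializes 0 0. Proof. exact: (specializes_nat 0). Qed.

Lemma specializes_1 : specializes 1 1. Proof. exact: (specializes_nat 1). Qed.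

Lemma specializesD f r g s :
  specializes f r -> specializes g s -> specializes (f + g) (r + s).
Proof.
move=> [N [M [M0 -> ->]]] [N' [M' [M'0 -> ->]]].
exists (N * M' + N' * M), (M * M').
rewrite !rmorphD !rmorphM /= mulf_neq0 //.
by split=> //; rewrite addf_div ?tofrac_eq0 ?rmorph_neq0.
Qed.

Lemma specializesM f r g s :
  specializes f r -> specializes g s -> specializes (f * g) (r * s).
Proof.
move=> [N [M [M0 -> ->]]] [N' [M' [M'0 -> ->]]].
exists (N * N'), (M * M').
by rewrite !rmorphM /= mulf_neq0 // !mulf_div.
Qed.

Lemma specializesN f r : specializes f r -> specializes (- f) (- r).
Proof.
move=> sf; rewrite -mulN1r -[- r]mulN1r.
exact: specializesM (specializes_int (-1)) sf.
Qed.

Lemma specializesB f r g s :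
  specializes f r -> specializes g s -> specializes (f - g) (r - s).
Proof. by move=> sf /specializesN; apply: specializesD. Qed.

Lemma specializesV f r :
  specializes f r -> r != 0 -> specializes f^-1 r^-1.
Proof.
move=> [N [M [M0 -> ->]]] r0; exists M, N; rewrite !invf_div; split=> //.
by apply: contraNneq r0 => ->; rewrite rmorph0 mul0r.
Qed.

Lemma specializes_div f r g s : specializes f r -> specializes g s ->
  s != 0 -> specializes (f / g) (r / s).
Proof. by move=> sf sg s0; apply/specializesM/specializesV. Qed.

Lemma specializes_exp n f r : specializes f r -> specializes (f ^+ n) (r ^+ n).
Proof.
move=> sf; elim: n => [|n IHn]; first exact: specializes_1.
by rewrite !exprS; apply: specializesM.
Qed.

Lemma specializes_exprz (z : int) f r :
  specializes f r -> r != 0 -> specializes (f ^ z) (r ^ z).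
Proof.
move=> sf r0; case: z => n; first exact: specializes_exp.
by apply: specializesV; [apply: specializes_exp | rewrite expf_neq0].
Qed.

Lemma specializes_sum (I : Type) (s : seq I) (P : pred I) f r :
  (forall i, P i -> specializes (f i) (r i)) ->
  specializes (\sum_(i <- s | P i) f i) (\sum_(i <- s | P i) r i).
Proof.
move=> sf; elim/big_ind2: _ => //; first exact: specializes_0.
by move=> *; apply: specializesD.
Qed.

Lemma specializes_prod (I : Type) (s : seq I) (P : pred I) f r :
  (forall i, P i -> specializes (f i) (r i)) ->
  specializes (\prod_(i <- s | P i) f i) (\prod_(i <- s | P i) r i).
Proof.
move=> sf; elim/big_ind2: _ => //; first exact: specializes_1.
by move=> *; apply: specializesM.
Qed.

Lemma specializes_det n (A : 'M_n) (B : 'M_n) :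
  (forall a b, specializes (A a b) (B a b)) -> specializes (\det A) (\det B).
Proof.
move=> sA; apply: specializes_sum => s _; apply: specializesM.
  exact/specializes_exp/specializesN/specializes_1.
by apply: specializes_prod => i _.
Qed.

(** Used to see that a determinant is nonzero by evaluating it at one point. *)
Lemma specializes_neq0 f r : specializes f r -> r != 0 -> f != 0.
Proof.
move=> [N [M [M0 -> ->]]]; apply: contraNneq => /eqP.
rewrite mulf_eq0 invr_eq0 !tofrac_eq0.
rewrite (negPf (rmorph_neq0 M0)) orbF => /eqP->.
by rewrite rmorph0 rmorph0 mul0r.
Qed.

(** The entries of the inverse are cofactors over the determinant, and only the
    latter is divided by. *)
Lemma specializes_invmx n (A : 'M_n) (B : 'M_n) a b :
  (forall a b, specializes (A a b) (B a b)) -> \det B != 0 ->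
  specializes (invmx A a b) (invmx B a b).
Proof.
move=> sA B0; have sdet := specializes_det sA.
have A0 := specializes_neq0 sdet B0.
rewrite /invmx !unitmxE !unitfE A0 B0 !mxE.
apply: specializesM; first exact: specializesV.
apply: specializesM; first exact/specializes_exp/specializesN/specializes_1.
by apply: specializes_det => i j; rewrite !mxE.
Qed.

End Specialization.

(** * Labels of the edges entering a crossing *)

Lemma count_take_lt (T : Type) (x0 : T) (a : pred T) (s : seq T) t t' :
  (t < t')%N -> (t < size s)%N -> a (nth x0 s t) ->
  (count a (take t s) < count a (take t' s))%N.
Proof.
move=> lt_tt' lt_ts at_.
have -> : take t' s = take t s ++ drop t (take t' s).
  by rewrite -{1}(cat_take_drop t (take t' s)) take_takel // ltnW.
rewrite count_cat -[ltnLHS]addn0 ltn_add2l -has_count.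
rewrite (drop_nth x0) /= ?nth_take ?at_ //.
by rewrite size_take; case: ifP.
Qed.

Lemma uniq_pmap (S T : eqType) (f : S -> option T) (s : seq S) :
  {in s &, forall x y, f x -> f x = f y -> x = y} -> uniq s ->
  uniq (pmap f s).
Proof.
elim: s => //= x s IHs inj_f /andP[xNs uniq_s].
have {}IHs : uniq (pmap f s).
  by apply: IHs => // y z ys zs; apply: inj_f; rewrite inE (ys, zs) orbT.
case fx: (f x) => [u|] //=; rewrite IHs andbT mem_pmap.
apply: contra xNs => /mapP[y ys uE].
suff -> : x = y by [].
by apply: inj_f; rewrite ?inE ?eqxx ?ys ?orbT // fx.
Qed.

Section Labels.
Variable D : upright_diagram.

Let w : seq event := D.

Lemma uniq_pieces : uniq (pieces w).
Proof.
apply: allpairs_uniq_dep => [|h _|]; rewrite ?iota_uniq //.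
by move=> [h p] [h' p'] _ _ /= [-> ->].
Qed.

Lemma uniq_walk : uniq [seq x.1 | x <- walk w].
Proof.
have /andP[_ /perm_uniq->] : is_long_knot w by rewrite /w; case: D => u uP; case/andP: (uP).
exact: uniq_pieces.
Qed.

Lemma onth_lt_size (T : Type) (s : seq T) n x : onth s n = Some x -> (n < size s)%N.
Proof. by elim: s n => [|y s IHs] [|n] //=; apply: IHs. Qed.

(** Uprightness makes the strands below a crossing the incoming ones. *)
Lemma walk_upwards h b q p :
  onth w h = Some (Cross b q) -> touches q p -> ((h, p), true) \in walk w.
Proof.
move=> wh; have h_lt := onth_lt_size wh.
have /allP up : all (upright_at w) (iota 0 (size w)).
  by rewrite /w; case: D => u uP; case/andP: (uP).
have /up : h \in iota 0 (size w) by rewrite mem_iota.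
by rewrite /upright_at wh => /andP[? ?] /orP[] /eqP->.
Qed.

Let start : state := ((0, 0), true).

Lemma nth_walk_upwards h b q p (t := index (h, p) [seq x.1 | x <- walk w]) :
  onth w h = Some (Cross b q) -> touches q p ->
  (t < size (walk w))%N /\ nth start (walk w) t = ((h, p), true).
Proof.
move=> wh tp; have hp_up := walk_upwards wh tp.
have hp_walk : (h, p) \in [seq x.1 | x <- walk w].
  by apply/mapP; exists ((h, p), true).
have t_lt : (t < size (walk w))%N by rewrite -(size_map fst) index_mem.
split=> //.
have [t' t'_lt def_hp] := nthP start hp_up.
rewrite -def_hp; congr nth; rewrite /t -[(h, p)]/(((h, p), true).1) -def_hp.
rewrite -(nth_map start start.1 fst t'_lt) index_uniq ?uniq_walk //.
by rewrite size_map.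
Qed.

(** Of two entries into crossings, the later one has the larger label, the
    earlier one being counted in it. *)
Lemma edge_of_piece_inj h b q p h' b' q' p' :
  onth w h = Some (Cross b q) -> touches q p ->
  onth w h' = Some (Cross b' q') -> touches q' p' ->
  edge_of_piece w (h, p) = edge_of_piece w (h', p') -> (h, p) = (h', p').
Proof.
move=> wh tp wh' tp'; rewrite /edge_of_piece /edge_at_time.
have [] := nth_walk_upwards wh tp; have [] := nth_walk_upwards wh' tp'.
set t := index (h, p) _; set t' := index (h', p') _.
move=> t'_lt nth_t' t_lt nth_t eq_count.
have in_t : enters_crossing w (nth start (walk w) t).
  by rewrite nth_t /enters_crossing wh.
have in_t' : enters_crossing w (nth start (walk w) t').
  by rewrite nth_t' /enters_crossing wh'.
have [lt_tt'|lt_t't|eq_tt'] := ltngtP t t'.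
- by have := count_take_lt lt_tt' t_lt in_t; rewrite eq_count ltnn.
- by have := count_take_lt lt_t't t'_lt in_t'; rewrite eq_count ltnn.
- by move: nth_t; rewrite eq_tt' nth_t' => -[-> ->].
Qed.

(** The walk visits each piece once, and a crossing has two pieces below it. *)
Lemma count_enters_le : (count (enters_crossing w) (walk w) <= last_edge w)%N.
Proof.
pose feet h := if onth w h is Some (Cross _ q) then [:: (h, q); (h, q.+1)]
               else [::].
have size_feet s : size (flatten (map feet s)) = (size (pmap (crossing_at w) s)).*2.
  elim: s => //= h s IHs; rewrite size_cat IHs {1}/feet /crossing_at.
  by case: (onth w h) => [[?|?|? ?]|] //=.
rewrite /last_edge /ncross /crossings -size_feet -size_filter.
rewrite -(size_map fst (filter _ _)).
apply: uniq_leq_size => [|a /mapP[[[h p] up]]].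
  apply: (subseq_uniq _ uniq_walk); apply: map_subseq; exact: filter_subseq.
rewrite mem_filter /enters_crossing /= => /andP[+ _] ->.
case wh: (onth w h) => [[?|?|b q]|] // /andP[_ tp].
apply/flattenP; exists (feet h).
  by apply: map_f; rewrite mem_iota (onth_lt_size wh).
by rewrite /feet wh !inE !xpair_eqE eqxx.
Qed.

Lemma edge_of_piece_lt h b q p :
  onth w h = Some (Cross b q) -> touches q p ->
  (edge_of_piece w (h, p) < last_edge w)%N.
Proof.
move=> wh tp; have [t_lt nth_t] := nth_walk_upwards wh tp.
apply: leq_trans count_enters_le.
rewrite -[X in (_ < count _ X)%N]take_size.
apply: (count_take_lt (x0 := start)) => //.
by rewrite nth_t /enters_crossing wh.
Qed.

(** The horizontal positions, just below a crossing, of the strands that are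
    about to pass over and under; b tells whether the crossing is positive. *)
Let over b q : nat := if b then q else q.+1.
Let under b q : nat := if b then q.+1 else q.

Lemma touches_over b q : touches q (over b q).
Proof. by case: b; rewrite /touches eqxx ?orbT. Qed.

Lemma touches_under b q : touches q (under b q).
Proof. by case: b; rewrite /touches eqxx ?orbT. Qed.

Lemma crossing_atP h c : crossing_at w h = Some c ->
  exists b q, onth w h = Some (Cross b q) /\
    c = ((-1) ^+ ~~ b, edge_of_piece w (h, over b q),
         edge_of_piece w (h, under b q)).
Proof.
rewrite /crossing_at; case wh: (onth w h) => [[?|?|b q]|] // [<-].
by exists b, q; case: b wh.
Qed.

Lemma crossingsP c : c \in crossings w -> exists h, crossing_at w h = Some c.
Proof. by rewrite mem_pmap => /mapP[h _ ->]; exists h. Qed.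

Lemma crossing_at_inj h h' c c' :
  crossing_at w h = Some c -> crossing_at w h' = Some c' -> c.2 = c'.2 -> h = h'.
Proof.
move=> /crossing_atP[b [q [wh ->]]] /crossing_atP[b' [q' [wh' ->]]] /=.
by move/(edge_of_piece_inj wh (touches_under _ _) wh' (touches_under _ _)) => -[].
Qed.

Lemma under_edge_inj : {in crossings w &, injective (fun c => c.2)}.
Proof.
move=> c c' /crossingsP[h hc] /crossingsP[h' hc'] /(crossing_at_inj hc hc') eq_h.
by move: hc; rewrite eq_h hc' => -[].
Qed.

Lemma uniq_crossings : uniq (crossings w).
Proof.
apply: uniq_pmap (iota_uniq _ _) => h h' _ _.
case hc: (crossing_at w h) => [c|] // _ /esym hc'.
exact: crossing_at_inj hc hc' _.
Qed.

Lemma over_edge_neq_under c c' :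
  c \in crossings w -> c' \in crossings w -> c.1.2 != c'.2.
Proof.
move=> /crossingsP[h /crossing_atP[b [q [wh ->]]]].
move=> /crossingsP[h' /crossing_atP[b' [q' [wh' ->]]]] /=; apply/eqP.
move/(edge_of_piece_inj wh (touches_over _ _) wh' (touches_under _ _)).
case=> eq_h; move: wh'; rewrite -eq_h wh => -[<- <-].
by rewrite /over /under; case: b {wh}; lia.
Qed.

Lemma over_edge_lt c : c \in crossings w -> (c.1.2 < last_edge w)%N.
Proof.
move=> /crossingsP[h /crossing_atP[b [q [wh ->]]]].
exact: edge_of_piece_lt wh (touches_over _ _).
Qed.

Lemma under_edge_lt c : c \in crossings w -> (c.2 < last_edge w)%N.
Proof.
move=> /crossingsP[h /crossing_atP[b [q [wh ->]]]].
exact: edge_of_piece_lt wh (touches_under _ _).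
Qed.

Lemma crossing_sign c : c \in crossings w -> c.1.1 = 1 \/ c.1.1 = -1.
Proof.
move=> /crossingsP[h /crossing_atP[b [q [_ ->]]]].
by case: b; [left | right].
Qed.

End Labels.

(** * The Alexander matrix and its inverse *)

(** The principal minors of a unitriangular matrix are unitriangular, so the
    diagonal cofactors are 1 just as the determinant. *)
Lemma unitriangular_invmx_diag (F : fieldType) n (U : 'M[F]_n) :
  (forall a b : 'I_n, (b <= a)%N -> U a b = (a == b)%:R) ->
  \det U = 1 /\ forall a, invmx U a a = 1.
Proof.
move=> U_tri.
have det1 m (V : 'M[F]_m) :
    (forall a b : 'I_m, (b <= a)%N -> V a b = (a == b)%:R) -> \det V = 1.
  move=> V_tri; rewrite -det_tr det_trig; last first.
    apply/is_trig_mxP => a b lt_ab; rewrite mxE V_tri ?(ltnW lt_ab) //.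
    by rewrite -val_eqE /= gtn_eqF.
  by apply: big1 => a _; rewrite mxE V_tri ?eqxx.
split=> [|a]; first exact: det1.
rewrite /invmx unitmxE det1 // unitr1 invr1 scale1r mxE /cofactor.
rewrite -signr_odd oddD addbb expr0 mul1r; apply: det1 => b c le_cb.
by rewrite !mxE U_tri /= ?leq_bump2 // (inj_eq lift_inj).
Qed.

Lemma sum_delta (F : pzRingType) (I : finType) (i : I) (f : I -> F) :
  \sum_k (k == i)%:R * f k = f i.
Proof.
rewrite (bigD1 i) //= eqxx mul1r big1 ?addr0 // => k /negPf->.
exact: mul0r.
Qed.

Section AlexanderMatrix.
Variables (F : fieldType) (D : upright_diagram) (T : F).

Let cs := crossings D.
Let A := A_mx D T.
Let g := green D T.

Lemma A_mxE a b :
  A a b = (a == b)%:R - \sum_(c <- cs)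
    (T ^ c.1.1 * ((a == inord c.1.2) && (b == inord c.1.2.+1))%:R
     + (1 - T ^ c.1.1) * ((a == inord c.1.2) && (b == inord c.2.+1))%:R
     + ((a == inord c.2) && (b == inord c.2.+1))%:R).
Proof.
rewrite /A /A_mx !mxE summxE; congr (_ - _).
by apply: eq_bigr => -[[s i] j] _; rewrite !mxE.
Qed.

Lemma inord_last_edge_eq i j : (i <= last_edge D)%N -> (j <= last_edge D)%N ->
  ((inord i : 'I_(last_edge D).+1) == inord j) = (i == j).
Proof. by move=> i_le j_le; rewrite -val_eqE /= !inordK. Qed.

(** The label j is the incoming under-edge of one crossing and the incoming edge
    of no other strand, so row j of the sum over crossings has a single term. *)
Lemma A_mx_under_row c b : c \in cs ->
  A (inord c.2) b = (inord c.2 == b)%:R - (b == inord c.2.+1)%:R.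
Proof.
move=> c_in; rewrite A_mxE (bigD1_seq c) ?uniq_crossings //=.
have lt_c := under_edge_lt c_in.
rewrite big_seq_cond big1 => [|c' /andP[c'_in neq_c']].
  rewrite !inord_last_edge_eq ?(ltnW (over_edge_lt c_in)) ?(ltnW lt_c) //.
  rewrite [c.2 == _]eq_sym (negPf (over_edge_neq_under c_in c_in)) eqxx /=.
  by rewrite !mulr0 !add0r addr0.
have lt_i := ltnW (over_edge_lt c'_in); have lt_j := ltnW (under_edge_lt c'_in).
rewrite !inord_last_edge_eq ?(ltnW lt_c) //.
rewrite [c.2 == c'.1.2]eq_sym (negPf (over_edge_neq_under c'_in c_in)).
rewrite (inj_in_eq (@under_edge_inj D)) // [c == _]eq_sym (negPf neq_c') /=.
by rewrite !mulr0 !add0r.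
Qed.

(** Column j+1 meets the crossings with an outgoing edge j+1; again there is
    only one, which reaches it from both of its incoming edges. *)
Lemma A_mx_under_col c a : c \in cs ->
  A a (inord c.2.+1) =
    (a == inord c.2.+1)%:R - (1 - T ^ c.1.1) * (a == inord c.1.2)%:R
    - (a == inord c.2)%:R.
Proof.
move=> c_in; rewrite A_mxE (bigD1_seq c) ?uniq_crossings //=.
have lt_c := under_edge_lt c_in.
rewrite big_seq_cond big1 => [|c' /andP[c'_in neq_c']].
  rewrite !inord_last_edge_eq ?(over_edge_lt c_in) //.
  rewrite !eqSS [c.2 == _]eq_sym (negPf (over_edge_neq_under c_in c_in)) eqxx.
  by rewrite !andbF !andbT mulr0 add0r addr0 opprD addrA.
have lt_i := over_edge_lt c'_in; have lt_j := under_edge_lt c'_in.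
rewrite !inord_last_edge_eq // !eqSS.
rewrite [c.2 == c'.1.2]eq_sym (negPf (over_edge_neq_under c'_in c_in)).
rewrite (inj_in_eq (@under_edge_inj D)) // [c == _]eq_sym (negPf neq_c').
by rewrite !andbF !mulr0 !add0r.
Qed.

Hypothesis detA : \det A != 0.

Lemma green_under_next_row c : c \in cs -> g c.2.+1 c.2 = g c.2 c.2 - 1.
Proof.
move=> c_in; have lt_c := under_edge_lt c_in.
have := @mulmxV _ _ A; rewrite unitmxE unitfE => /(_ detA).
move/matrixP/(_ (inord c.2) (inord c.2)); rewrite !mxE eqxx.
under eq_bigr => b _ do rewrite A_mx_under_row // mulrBl eq_sym.
rewrite sumrB !sum_delta => /eqP; rewrite subr_eq => /eqP g_jj.
by rewrite /g /green -/A g_jj addrC addKr.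
Qed.

Lemma green_under_next_col c : c \in cs ->
  g c.2 c.2.+1 = (1 - T ^ c.1.1) * g c.2 c.1.2 + g c.2 c.2.
Proof.
move=> c_in; have lt_c := under_edge_lt c_in.
have := @mulVmx _ _ A; rewrite unitmxE unitfE => /(_ detA).
move/matrixP/(_ (inord c.2) (inord c.2.+1)); rewrite !mxE.
under eq_bigr => a _ do rewrite A_mx_under_col // mulrC 2!mulrBl -mulrA.
rewrite !sumrB -mulr_sumr !sum_delta inord_last_edge_eq ?(ltnW lt_c) //.
rewrite ltn_eqF // => /eqP; rewrite !subr_eq add0r => /eqP g_jj'.
by rewrite /g /green -/A g_jj' addrC.
Qed.

End AlexanderMatrix.

(** At T = 1 the coefficient 1 - T^s of E_{i,j+1} vanishes; it is the only
    elementary matrix of A that can lie on or below the diagonal. *)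
Lemma A_mx_1_unitriangular (F : fieldType) (D : upright_diagram)
    (a b : 'I_(last_edge D).+1) :
  (b <= a)%N -> A_mx D (1 : F) a b = (a == b)%:R.
Proof.
move=> le_ba; rewrite A_mxE.
have succ_lt i : (i < last_edge D)%N ->
    ((a == inord i) && (b == inord i.+1)) = false.
  move=> i_lt; apply: contraTF le_ba => /andP[/eqP-> /eqP->].
  by rewrite !inordK ?ltnn // ltnW.
rewrite big_seq big1 ?subr0 // => c c_in.
rewrite exp1rz subrr !succ_lt ?over_edge_lt ?under_edge_lt //.
by rewrite mulr0 mul0r !add0r.
Qed.

Lemma det_A_mx_1 (F : fieldType) (D : upright_diagram) : \det (A_mx D (1 : F)) = 1.
Proof. exact: (unitriangular_invmx_diag (@A_mx_1_unitriangular F D)).1. Qed.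

Lemma green_1_diag (F : fieldType) (D : upright_diagram) i :
  green D (1 : F) i i = 1.
Proof. exact: (unitriangular_invmx_diag (@A_mx_1_unitriangular F D)).2. Qed.

Lemma Alexander_1 (F : fieldType) (D : upright_diagram) : Alexander D (1 : F) = 1.
Proof. by rewrite /Alexander exp1rz det_A_mx_1 mulr1. Qed.

Section SpecializeAlexander.
Variables (R S : idomainType) (phi : {rmorphism R -> S}) (D : upright_diagram).
Variables (T : {fraction R}) (t : {fraction S}).
Hypotheses (T_t : specializes phi T t) (t0 : t != 0).

Lemma specializes_A_mx a b : specializes phi (A_mx D T a b) (A_mx D t a b).
Proof.
have T_s s := specializes_exprz s T_t t0.
rewrite !A_mxE; apply: specializesB; first exact: specializes_nat.
apply: specializes_sum => c _.
apply: specializesD; last exact: specializes_nat.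
apply: specializesD; apply: specializesM; try exact: specializes_nat.
  exact: T_s.
by apply: specializesB; first exact: specializes_1.
Qed.

Lemma specializes_Alexander : specializes phi (Alexander D T) (Alexander D t).
Proof.
apply: specializesM; first exact: specializes_exprz.
exact/specializes_det/specializes_A_mx.
Qed.

Lemma specializes_green a b : \det (A_mx D t) != 0 ->
  specializes phi (green D T a b) (green D t a b).
Proof. by move=> ?; apply: specializes_invmx => // *; apply: specializes_A_mx. Qed.

End SpecializeAlexander.

(** The left-hand side is F1 at T1 = 1, where x = T2^s = T3^s; the right-hand
    side is - R1, with g_{j+1,j} and g_{j,j+1} expressed by g_jj and g_ji.  Any
    value of half will do, so that 2 may vanish in F. *)
Lemma F1_limit_eq (F : fieldType) (sgn half x gii gij gji gjj g1ji : F) :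
  x - 1 != 0 ->
  sgn * (half - gii + x * 1 * gji - x * gjj * gji - (x - 1) * gii * gji
         + (x - 1) * gji * gji - 1 * gjj + 2 * gii * gjj + 1 * gjj - gii * gjj)
  + sgn / (x - 1) *
    ((1 - 1) * x * (gjj * g1ji - gjj * g1ji + x * g1ji * gji)
     + (x - 1) * gji * (1 - x * 1 + gij + (x - 2) * gjj
                        - (1 - 1) * (x + 1) * g1ji))
  = - (sgn * (gji * (gjj - 1 + ((1 - x) * gji + gjj) - gij)
              - gii * ((1 - x) * gji + gjj - 1) - half)).
Proof. by move=> x_neq1; field. Qed.

Lemma exp_sign_eq1 (F : fieldType) (x : F) (s : int) :
  s = 1 \/ s = -1 -> (x ^ s == 1) = (x == 1).
Proof. by case=> ->; rewrite ?expr1z // exprN1 invr_eq1. Qed.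

(** * Setting T1 to 1 *)

Section SpecializeTheta.
Variables (C : fieldType) (D : upright_diagram).

Let t : {fraction {poly C}} := varT C.
Let at1 := specializes (horner_eval (1 : {poly C})).

Lemma varT_neq0 : t != 0.
Proof. by rewrite /t /varT tofrac_eq0 polyX_eq0. Qed.

Lemma varT_exp_sign_neq1 c : c \in crossings D -> t ^ c.1.1 - 1 != 0.
Proof.
move=> c_in; rewrite subr_eq0 exp_sign_eq1; last exact: crossing_sign c_in.
by rewrite -subr_eq0 /t /varT -(rmorph1 (@FracField.tofrac _)) -rmorphB
  tofrac_eq0 polyXsubC_eq0.
Qed.

Lemma specializes_T1 : at1 (T1 C) 1.
Proof.
have := specializes_tofrac (horner_eval (1 : {poly C})) 'X.
by rewrite /= /horner_eval hornerX rmorph1.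
Qed.

Lemma specializes_T2 : at1 (T2 C) t.
Proof.
have := specializes_tofrac (horner_eval (1 : {poly C})) 'X%:P.
by rewrite /= /horner_eval hornerC.
Qed.

Lemma specializes_T3 : at1 (T3 C) t.
Proof. rewrite -[t]mul1r; exact: specializesM specializes_T1 specializes_T2. Qed.

(** The specialization T <- 1 sends this determinant to 1. *)
Lemma det_A_mx_varT_neq0 : \det (A_mx D t) != 0.
Proof.
have t_1 : specializes (horner_eval (1 : C)) t 1.
  have := specializes_tofrac (horner_eval (1 : C)) 'X.
  by rewrite /= /horner_eval hornerX rmorph1.
have sdet := specializes_det (@specializes_A_mx _ _ _ D _ _ t_1 (oner_neq0 _)).
by apply: specializes_neq0 sdet _; rewrite det_A_mx_1 oner_neq0.
Qed.

Lemma specializes_green1 a b : at1 (green D (T1 C) a b) (green D 1 a b).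
Proof.
apply: (specializes_green specializes_T1 (oner_neq0 _)).
by rewrite det_A_mx_1 oner_neq0.
Qed.

Lemma specializes_green2 a b : at1 (green D (T2 C) a b) (green D t a b).
Proof.
exact: (specializes_green specializes_T2 varT_neq0 a b det_A_mx_varT_neq0).
Qed.

Lemma specializes_green3 a b : at1 (green D (T3 C) a b) (green D t a b).
Proof.
exact: (specializes_green specializes_T3 varT_neq0 a b det_A_mx_varT_neq0).
Qed.

Lemma specializes_half : at1 2^-1 2^-1.
Proof.
(* The field of constants embeds in both fields of fractions. *)
have := specializes_tofrac (horner_eval (1 : {poly C})) (2^-1)%:P%:P.
rewrite /= /horner_eval hornerC.
have := fmorphV (@FracField.tofrac _ \o polyC \o polyC) (2 : C).
rewrite rmorph_nat /= => ->.
have := fmorphV (@FracField.tofrac _ \o polyC) (2 : C).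
by rewrite rmorph_nat /= => ->.
Qed.

(** Lets the value be synthesized from the shape of f before it is compared with
    the expected one. *)
Lemma specializes_to f r r' : at1 f r -> r = r' -> at1 f r'.
Proof. by move=> ? <-. Qed.

Ltac specialize_all :=
  lazymatch goal with |- _ ?f _ => lazymatch f with
  | - _ => apply: specializesN; specialize_all
  | _ + _ => apply: specializesD; specialize_all
  (* The denominators of F1 and F2; they are left to be shown nonzero. *)
  | _ * (_ ^ _ - 1)^-1 =>
      apply: specializes_div; [specialize_all | specialize_all | ]
  | _ * _ => apply: specializesM; specialize_all
  | T1 C ^ _ => exact: specializes_exprz specializes_T1 (oner_neq0 _)
  | T2 C ^ _ => exact: specializes_exprz specializes_T2 varT_neq0
  | T3 C ^ _ => exact: specializes_exprz specializes_T3 varT_neq0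
  | green D (T1 C) _ _ => exact: specializes_green1
  | green D (T2 C) _ _ => exact: specializes_green2
  | green D (T3 C) _ _ => exact: specializes_green3
  | 2^-1 => exact: specializes_half
  | _%:~R => exact: specializes_int
  | 1 => exact: specializes_1
  | _%:R => exact: specializes_nat
  end end.

Lemma specializes_F3 k :
  at1 (F3 C D k) ((rotation D k)%:~R * (green D t k k - 2^-1)).
Proof. by rewrite /F3; specialize_all. Qed.

(** The numerator has the factor T1^s0 - 1, and the denominator T2^s1 - 1
    survives the specialization. *)
Lemma specializes_F2 c0 c1 : c1 \in crossings D -> at1 (F2 C D c0 c1) 0.
Proof.
move=> c1_in; have := varT_exp_sign_neq1 c1_in.
case: c0 c1 {c1_in} => [[s0 i0] j0] [[s1 i1] j1] /= ts_neq1.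
apply: specializes_to.
  by rewrite /F2; specialize_all; exact: ts_neq1.
by rewrite exp1rz subrr mulr0 !mul0r.
Qed.

Lemma specializes_F1 c : c \in crossings D -> at1 (F1 C D c) (- R1 D t c).
Proof.
move=> c_in; have := varT_exp_sign_neq1 c_in.
have := green_under_next_row det_A_mx_varT_neq0 c_in.
have := green_under_next_col det_A_mx_varT_neq0 c_in.
case: c {c_in} => [[s i] j] /= g_col g_row ts_neq1.
apply: specializes_to.
  by rewrite /F1; specialize_all; exact: ts_neq1.
rewrite g_col g_row exp1rz !green_1_diag.
exact: F1_limit_eq ts_neq1.
Qed.

Lemma specializes_theta : at1 (theta C D) (- rho1 C D).
Proof.
apply: specializes_to.
  apply: specializesM; first apply: specializesM; first apply: specializesM.
  - exact: specializes_Alexander specializes_T1 (oner_neq0 _).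
  - exact: specializes_Alexander specializes_T2 varT_neq0.
  - exact: specializes_Alexander specializes_T3 varT_neq0.
  apply: specializesD; first apply: specializesD.
  - rewrite big_seq; apply: specializes_sum => c; exact: specializes_F1.
  - apply: specializes_sum => c0 _; rewrite big_seq.
    by apply: specializes_sum => c1; apply: specializes_F2.
  - by apply: specializes_sum => k _; apply: specializes_F3.
rewrite /rho1 -big_seq sumrN Alexander_1.
rewrite [X in _ + X + _]big1 => [|c0 _]; last by rewrite big1.
by rewrite mul1r -expr2 addr0 -mulrN opprB addrC.
Qed.

End SpecializeTheta.

Theorem theorem1 (R : realType) (K : knot) (D : upright_diagram) :
  represents D K ->
  specializes_at_T1_1 (theta R[i] D) (- rho1 R[i] D).
Proof. by move=> _; apply: specializes_theta. Qed.
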